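(* Let $m\ge1$, $r\ge0$ be integers, let $\mathcal D\in NLDO_r$ with total symbol $\lambda\in C^\infty(\mathcal J^r_{m,1},\mathbb R)$, and let $g\in{}^*C^\infty(\mathbb R^m,\mathbb R)$. Suppose that $({}^*\lambda,g)$ satisfies ${}^\sigma PCP$. Then $\mathcal D(f)=g$ has a generalized solution, i.e. there exists $f\in{}^*C^\infty(\mathbb R^m,\mathbb R)$ such that ${}^*\mathcal D(f)({}^*x)=g({}^*x)$ for every $x\in\mathbb R^m$.
   Context: Nonstandard setting: a fixed superstructure nonstandard extension $*$ that is polysaturated ($\kappa$-saturated with $\kappa$ larger than the cardinality of the standard superstructure). ${}^*C^\infty(\mathbb R^m,\mathbb R)$ is the set of internal *smooth functions ${}^*\mathbb R^m\to{}^*\mathbb R$. $\mathcal J^r_{m,1}$ is the bundle over $\mathbb R^m$ of $r$-jets $j^r_xf$ of functions $f\in C^\infty(\mathbb R^m,\mathbb R)$, with projection $\pi^r:\mathcal J^r_{m,1}\to\mathbb R^m$; it is a smooth manifold with global coordinates $(x_i,y_\alpha)_{1\le i\le m,|\alpha|\le r}$, $y_\alpha(j^r_xf)=\partial^\alpha f(x)$. $NLDO_r$ is the set of (possibly nonlinear) operators $\mathcal D:C^\infty(\mathbb R^m,\mathbb R)\to C^\infty(\mathbb R^m,\mathbb R)$ of the form $\mathcal D(f)(x)=\lambda(j^r_xf)$ for a smooth function $\lambda:\mathcal J^r_{m,1}\to\mathbb R$, the total symbol of $\mathcal D$. ${}^\sigma PCP$ (pointwise covering property): for $\Lambda\in{}^*C^\infty(\mathcal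 J^r_{m,1},\mathbb R)$ and $g\in{}^*C^\infty(\mathbb R^m,\mathbb R)$, the pair $(\Lambda,g)$ satisfies ${}^\sigma PCP$ if for every $x\in\mathbb R^m$ there is $p\in({}^*\pi^r)^{-1}({}^*x)\subset{}^*\mathcal J^r_{m,1}$ with $\Lambda(p)=g({}^*x)$. *)

(* Defs.v *)
From mathcomp Require Import all_boot all_order all_algebra.
From mathcomp Require Import all_classical all_reals all_analysis.
Import Order.TTheory GRing.Theory Num.Theory.
Import numFieldNormedType.Exports.

Set Implicit Arguments.
Unset Strict Implicit.
Unset Printing Implicit Defensive.

Local Open Scope classical_set_scope.
Local Open Scope ring_scope.

(** * Superstructures *)

(* The levels V_n(X), where V_0(X) = X and V_{n+1}(X) = V_n(X) U P(V_n(X));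
   every superstructure is isomorphic to the union of the V_n(X), by
   [ss_rank], [ss_ext] and [ss_collectP]. *)
Fixpoint ss_level_of (X U : Type) (elt : U -> U -> Prop) (atom : X -> U)
    (n : nat) : set U :=
  if n is k.+1 then
    ss_level_of elt atom k `|`
      [set A | ~ range atom A /\
               [set y | elt y A] `<=` ss_level_of elt atom k]
  else range atom.

(* [ss_collect P] is the set {y | P y}; it is unspecified when P is not
   included in some level. *)
Record superstructure (X : Type) := Superstructure {
  ss_sort :> Type;
  elt : ss_sort -> ss_sort -> Prop;
  atom : X -> ss_sort;
  ss_collect : set ss_sort -> ss_sort;
  ss_atom_inj : injective atom;
  ss_atom_empty : forall x y, ~ elt y (atom x);
  ss_ext : forall A B, ~ range atom A -> ~ range atom B ->
    (forall y, elt y A <-> elt y B) -> A = B;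
  ss_rank : forall a, exists n, ss_level_of elt atom n a;
  ss_collectP : forall n (P : set ss_sort), P `<=` ss_level_of elt atom n ->
    ~ range atom (ss_collect P) /\ forall y, elt y (ss_collect P) <-> P y
}.

Arguments elt {X s} _ _.
Arguments atom {X s} _.
Arguments ss_collect {X s} _.

Definition ss_set (X : Type) (V : superstructure X) (A : V) : Prop :=
  ~ range atom A.

Definition kpair (X : Type) (V : superstructure X) (a b : V) : V :=
  ss_collect [set ss_collect [set a]; ss_collect [set a; b]].

(* The value at [a] of a function given by its graph, and the empty set off
   its domain. *)
Definition app (X : Type) (V : superstructure X) (f a : V) : V :=
  if pselect (exists b, elt (kpair a b) f) is left h then projT1 (cid h)
  else ss_collect set0.

(** * Nonstandard extensions *)

(* Bounded formulas of the language {=, in}, with variables indexed by nat;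
   [FAll i j p] is "for all x_i in x_j, p". Constants of the superstructure
   enter as values of free variables. *)
Inductive formula :=
  | FEq of nat & nat
  | FElt of nat & nat
  | FNot of formula
  | FAnd of formula & formula
  | FAll of nat & nat & formula.

Fixpoint holds (X : Type) (V : superstructure X) (e : nat -> V) (p : formula)
    : Prop :=
  match p with
  | FEq i j => e i = e j
  | FElt i j => elt (e i) (e j)
  | FNot q => ~ holds e q
  | FAnd q1 q2 => holds e q1 /\ holds e q2
  | FAll i j q => forall a, elt a (e j) ->
      holds (fun k => if k == i then a else e k) q
  end.

(* [star_base] is *X = Y; with transfer it makes [star] map atoms to atoms and
   sets to sets. *)
Record nonstandard_extension (X Y : Type)
    (V : superstructure X) (W : superstructure Y) := NonstandardExtension {
  star :> V -> W;
  star_base : star (ss_collect (range atom)) = ss_collect (range atom);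
  star_transfer : forall (p : formula) (e : nat -> V),
    holds e p <-> holds (fun k => star (e k)) p
}.

Definition internal (X Y : Type) (V : superstructure X) (W : superstructure Y)
    (star : nonstandard_extension V W) (A : W) : Prop :=
  exists B : V, elt A (star B).

(* Saturation at the cardinal of the type K. *)
Definition saturated (X Y : Type) (V : superstructure X) (W : superstructure Y)
    (star : nonstandard_extension V W) (K : Type) : Prop :=
  forall F : set W,
    (forall A, F A -> ss_set A /\ internal star A) ->
    (F #<= [set: K])%card -> ~ ([set: K] #<= F)%card ->
    (forall G : set W, G `<=` F -> finite_set G ->
       exists y, forall A, G A -> elt y A) ->
    exists y, forall A, F A -> elt y A.

Definition polysaturated (X Y : Type) (V : superstructure X)
    (W : superstructure Y) (star : nonstandard_extension V W) : Prop :=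
  exists K : Type,
    [/\ ([set: V] #<= [set: K])%card, ~ ([set: K] #<= [set: V])%card
      & saturated star K].

(** * Smooth functions and jets *)

Definition partial (R : realType) (n : nat) (i : 'I_n) (f : 'rV[R]_n -> R)
    : 'rV[R]_n -> R :=
  fun x => 'D_(delta_mx 0 i) f x.

Definition partials (R : realType) (n : nat) (s : seq 'I_n)
    (f : 'rV[R]_n -> R) : 'rV[R]_n -> R :=
  foldr (fun i h => partial i h) f s.

Definition smooth (R : realType) (n : nat) (f : 'rV[R]_n -> R) : Prop :=
  forall s : seq 'I_n,
    continuous (partials s f) /\
    forall (i : 'I_n) (x : 'rV[R]_n),
      derivable (partials s f) x (delta_mx 0 i).

Record Cinf (R : realType) (n : nat) := MkCinf {
  cinf_fun :> 'rV[R]_n -> R;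
  cinf_smooth : smooth cinf_fun
}.

(* Multi-indices of length at most r. *)
Definition midx (m r : nat) :=
  {a : {ffun 'I_m -> 'I_r.+1} | (\sum_i a i <= r)%N}.

Definition Dmidx (R : realType) (m r : nat) (a : midx m r)
    (f : 'rV[R]_m -> R) : 'rV[R]_m -> R :=
  partials (flatten [seq nseq (val a i) i | i <- enum 'I_m]) f.

Definition jet_class (R : realType) (m r : nat) (x : 'rV[R]_m) (f : Cinf R m)
    : set (Cinf R m) :=
  [set h | forall a : midx m r, Dmidx a h x = Dmidx a f x].

(* An r-jet is a base point x with an equivalence class of smooth functions
   having the same derivatives of order at most r at x. *)
Record jet (R : realType) (m r : nat) := MkJet {
  jet_pi : 'rV[R]_m;
  jet_fun : set (Cinf R m);
  jet_ex : exists f, jet_fun = jet_class r jet_pi f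
}.

Definition jet_of (R : realType) (m r : nat) (x : 'rV[R]_m) (f : Cinf R m)
    : jet R m r :=
  MkJet (ex_intro _ f (erefl (jet_class r x f))).

(* The coordinates (x_i, y_a) of the jet of f at x. *)
Definition jet_coord (R : realType) (m r : nat) (x : 'rV[R]_m) (f : Cinf R m)
    : 'rV[R]_(m + #|{: midx m r}|) :=
  row_mx x (\row_k Dmidx (enum_val k : midx m r) f x).

(* Smoothness of a function on the jet manifold, read in the global chart. *)
Definition jet_smooth (R : realType) (m r : nat) (l : jet R m r -> R) : Prop :=
  exists2 L : 'rV[R]_(m + #|{: midx m r}|) -> R, smooth L &
    forall x f, l (jet_of r x f) = L (jet_coord r x f).

Definition total_symbol (R : realType) (m r : nat)
    (D : Cinf R m -> Cinf R m) (l : jet R m r -> R) : Prop :=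
  jet_smooth l /\ forall f x, D f x = l (jet_of r x f).

(** * Mathematical objects as elements of a superstructure

   The individuals X contain the real numbers through [iota : R -> X]. A
   vector is the function i |-> x_i on {0, ..., n-1}, a function is its graph,
   and ordered pairs are Kuratowski pairs. *)

Definition code_graph (X : Type) (V : superstructure X) (A B : Type)
    (cA : A -> V) (cB : B -> V) (f : A -> B) : V :=
  ss_collect (range (fun a => kpair (cA a) (cB (f a)))).

Definition code_real (R : realType) (X : Type) (V : superstructure X)
    (iota : R -> X) (t : R) : V :=
  atom (iota t).

Definition code_vec (R : realType) (X : Type) (V : superstructure X)
    (iota : R -> X) (n : nat) (x : 'rV[R]_n) : V :=
  code_graph (fun i : 'I_n => code_real V iota i%:R) (code_real V iota)
    (fun i => x 0 i).

Definition code_cinf (R : realType) (X : Type) (V : superstructure X)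
    (iota : R -> X) (n : nat) (f : Cinf R n) : V :=
  code_graph (@code_vec R X V iota n) (code_real V iota) f.

Definition code_jet (R : realType) (X : Type) (V : superstructure X)
    (iota : R -> X) (m r : nat) (p : jet R m r) : V :=
  kpair (code_vec V iota (jet_pi p))
        (ss_collect (@code_cinf R X V iota m @` jet_fun p)).

(* The sets C^oo(R^n, R) and J^r_{m,1}. *)
Definition code_Cinf (R : realType) (X : Type) (V : superstructure X)
    (iota : R -> X) (n : nat) : V :=
  ss_collect (range (@code_cinf R X V iota n)).

Definition code_Jet (R : realType) (X : Type) (V : superstructure X)
    (iota : R -> X) (m r : nat) : V :=
  ss_collect (range (@code_jet R X V iota m r)).

Definition code_proj (R : realType) (X : Type) (V : superstructure X)
    (iota : R -> X) (m r : nat) : V :=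
  code_graph (@code_jet R X V iota m r) (@code_vec R X V iota m)
    (@jet_pi R m r).

Definition code_symbol (R : realType) (X : Type) (V : superstructure X)
    (iota : R -> X) (m r : nat) (l : jet R m r -> R) : V :=
  code_graph (@code_jet R X V iota m r) (code_real V iota) l.

Definition code_operator (R : realType) (X : Type) (V : superstructure X)
    (iota : R -> X) (m : nat) (D : Cinf R m -> Cinf R m) : V :=
  code_graph (@code_cinf R X V iota m) (@code_cinf R X V iota m) D.

(** * The pointwise covering property and generalized solutions *)

Definition sigmaPCP (R : realType) (X Y : Type) (V : superstructure X)
    (W : superstructure Y) (star : nonstandard_extension V W) (iota : R -> X)
    (m r : nat) (Lambda g : W) : Prop :=
  forall x : 'rV[R]_m, exists p : W,
    [/\ elt p (star (code_Jet V iota m r)),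
        app (star (code_proj V iota m r)) p = star (code_vec V iota x)
      & app Lambda p = app g (star (code_vec V iota x))].

Definition generalized_solution (R : realType) (X Y : Type)
    (V : superstructure X) (W : superstructure Y)
    (star : nonstandard_extension V W) (iota : R -> X) (m : nat)
    (D : Cinf R m -> Cinf R m) (g f : W) : Prop :=
  elt f (star (code_Cinf V iota m)) /\
  forall x : 'rV[R]_m,
    app (app (star (code_operator V iota D)) f) (star (code_vec V iota x)) =
    app g (star (code_vec V iota x)).

(* Main.v *)
Require Import Defs.
From mathcomp Require Import all_boot all_order all_algebra.
From mathcomp Require Import all_classical all_reals all_analysis.
From mathcomp Require Import ring.
Import Order.TTheory GRing.Theory Num.Theory.
Import numFieldNormedType.Exports.

(* In the standard world, the values of D f at finitely many points can be
   prescribed independently within the ranges of the maps f |-> D f x: given f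
   and g, a polynomial cutoff equal to 1 to order r at x and to 0 to order r at
   x_1, ..., x_k produces a smooth h with the r-jet of f at x and those of g at
   the x_i. For xs a finite list of standard points, let B_xs be the set of the
   fibers of f |-> (D f y)_{y in xs}. By PCP and transfer, for each standard x
   some A_x in *B_[x] consists of functions F such that *D F and g agree at *x. The
   gluing, transferred one point at a time, gives the A_x the finite
   intersection property, and saturation gives a common element. *)

Set Implicit Arguments.
Unset Strict Implicit.
Unset Printing Implicit Defensive.

Local Open Scope classical_set_scope.
Local Open Scope ring_scope.

(** * Calculus of smooth functions *)

Section Smooth.
Variables (R : realType) (n : nat).
Implicit Types (f g u v w : 'rV[R]_n -> R) (x : 'rV[R]_n) (i : 'I_n).

Definition gradable f := forall i x, derivable f x (delta_mx 0 i).

Lemma partials_rcons s i f : partials (rcons s i) f = partials s (partial i f).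
Proof. by rewrite /partials -cats1 foldr_cat. Qed.

Lemma smooth_partial i f : smooth f -> smooth (partial i f).
Proof. by move=> fS s; rewrite -partials_rcons. Qed.

Lemma smooth_continuous f : smooth f -> continuous f.
Proof. by move=> /(_ [::])[]. Qed.

Lemma smooth_gradable f : smooth f -> gradable f.
Proof. by move=> /(_ [::])[]. Qed.

Lemma partialD i f g : gradable f -> gradable g ->
  partial i (f \+ g) = partial i f \+ partial i g.
Proof. by move=> df dg; apply/funext => x; rewrite /partial deriveD. Qed.

Lemma partialM i f g : gradable f -> gradable g ->
  partial i (f \* g) = (f \* partial i g) \+ (partial i f \* g).
Proof.
move=> df dg; apply/funext => x; rewrite /partial deriveM//.
by rewrite /GRing.scale/= [g x * _]mulrC.
Qed.

Lemma partial_cst i (c : R) : partial i (fun _ : 'rV[R]_n => c) = fun=> 0.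
Proof. by apply/funext => x; apply: derive_cst. Qed.

Lemma is_derive_coord (j : 'I_n) x (d : 'rV[R]_n) :
  is_derive x d (fun y : 'rV[R]_n => y 0 j) (d 0 j).
Proof.
have H : h^-1 *: (((fun y : 'rV[R]_n => y 0 j) \o shift x) (h *: d) - x 0 j)
    @[h --> (0 : R)^'] --> d 0 j.
  (* Off h = 0 the difference quotient is constantly d 0 j. *)
  apply: cvg_near_cst. near=> h.
  rewrite /= !mxE addrK /GRing.scale/= mulKf//.
  by near: h; exact: nbhs_dnbhs_neq.
by apply: DeriveDef; [apply/cvg_ex; exists (d 0 j)|apply/cvg_lim].
Unshelve. all: by end_near. Qed.

(* This class is visibly stable under partial derivatives, so its members are
   smooth without any higher-order Leibniz formula. *)
Inductive smooth_alg : ('rV[R]_n -> R) -> Prop :=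
  | alg_smooth f of smooth f : smooth_alg f
  | alg_cst c : smooth_alg (fun=> c)
  | alg_coord j : smooth_alg (fun x => x 0 j)
  | alg_add f g of smooth_alg f & smooth_alg g : smooth_alg (f \+ g)
  | alg_mul f g of smooth_alg f & smooth_alg g : smooth_alg (f \* g).

Lemma smooth_alg_continuous f : smooth_alg f -> continuous f.
Proof.
elim=> [g /smooth_continuous//|c|j|g h _ cg _ ch|g h _ cg _ ch] x.
- exact: (@cst_continuous _ _ c).
- exact: coord_continuous.
- exact: (continuousD (cg x) (ch x)).
- exact: (continuousM (cg x) (ch x)).
Qed.

Lemma smooth_alg_gradable f : smooth_alg f -> gradable f.
Proof.
elim=> [g /smooth_gradable//|c|j|g h _ dg _ dh|g h _ dg _ dh] i x.
- exact: derivable_cst.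
- by have [] := is_derive_coord j x (delta_mx 0 i).
- exact: derivableD.
- exact: derivableM.
Qed.

Lemma smooth_alg_partial i f : smooth_alg f -> smooth_alg (partial i f).
Proof.
elim=> [g /smooth_partial gS|c|j|g h gA Ag hA Ah|g h gA Ag hA Ah].
- exact: alg_smooth.
- by rewrite partial_cst; exact: alg_cst.
- rewrite (_ : partial _ _ = fun=> (delta_mx 0 i : 'rV_n) 0 j).
    exact: alg_cst.
  by apply/funext => x; rewrite /partial (@derive_val _ _ _ _ _ _ _ (is_derive_coord j x _)).
- by rewrite partialD; [exact: alg_add|exact: smooth_alg_gradable..].
- rewrite partialM; [|exact: smooth_alg_gradable..].
  by apply: alg_add; exact: alg_mul.
Qed.

(** Peeling s from the right differentiates f first and stays in the class, so continuity and
    first-order differentiability suffice. *)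
Lemma smooth_algP f : smooth_alg f -> smooth f.
Proof.
move=> + s; elim/last_ind: s f => [|s i IHs] f fA.
  by split; [exact: smooth_alg_continuous|exact: smooth_alg_gradable].
by rewrite partials_rcons; apply: IHs; exact: smooth_alg_partial.
Qed.

Lemma smooth_cst c : smooth (fun _ : 'rV[R]_n => c).
Proof. by apply: smooth_algP; exact: alg_cst. Qed.

Lemma smooth_coord j : smooth (fun x : 'rV[R]_n => x 0 j).
Proof. by apply: smooth_algP; exact: alg_coord. Qed.

Lemma smoothD f g : smooth f -> smooth g -> smooth (f \+ g).
Proof. by move=> *; apply: smooth_algP; apply: alg_add; exact: alg_smooth. Qed.

Lemma smoothM f g : smooth f -> smooth g -> smooth (f \* g).
Proof. by move=> *; apply: smooth_algP; apply: alg_mul; exact: alg_smooth. Qed.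

Lemma smoothX f k : smooth f -> smooth (fun x => f x ^+ k).
Proof.
move=> fS; elim: k => [|k IHk]; first exact: smooth_cst.
by under eq_fun do rewrite exprS; exact: smoothM.
Qed.

(** * Orders of vanishing and gluing of jets *)

Lemma partialsD s f g : smooth f -> smooth g ->
  partials s (f \+ g) = partials s f \+ partials s g.
Proof.
elim/last_ind: s f g => [|s i IHs] f g fS gS //.
rewrite !partials_rcons partialD; [|exact: smooth_gradable..].
exact: IHs (smooth_partial i fS) (smooth_partial i gS).
Qed.

(** A derivative costs one power of v; the existential cofactor w' lets this iterate. *)
Lemma partial_powM k i v w : smooth v -> smooth w ->
  exists2 w', smooth w' &
    partial i (fun x => v x ^+ k.+1 * w x) = (fun x => v x ^+ k * w' x).
Proof.
move=> vS wS; elim: k => [|k [w' w'S IHk]].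
  exists (partial i (v \* w)); first exact/smooth_partial/smoothM.
  by apply/funext => x; rewrite mul1r.
(* Product rule on v * (v^(k+1) w): each of the two terms keeps a factor v^(k+1). *)
exists (w' \+ (partial i v \* w)).
  exact: smoothD w'S (smoothM (smooth_partial i vS) wS).
rewrite (_ : (fun x => _) = v \* (fun x => v x ^+ k.+1 * w x)); last first.
  by apply/funext => x /=; rewrite mulrA -exprS.
rewrite partialM; first last.
- exact: smooth_gradable (smoothM (smoothX k.+1 vS) wS).
- exact: smooth_gradable vS.
rewrite IHk; apply/funext => x /=.
by rewrite exprS; ring.
Qed.

Lemma partials_powM k s v w : smooth v -> smooth w -> (size s <= k)%N ->
  exists2 w', smooth w' &
    partials s (fun x => v x ^+ k * w x) = (fun x => v x ^+ (k - size s) * w' x).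
Proof.
move=> vS wS; elim: s => [|i s IHs] sk; first by exists w; rewrite ?subn0.
have [w' w'S /= ->] := IHs (ltnW sk).
by rewrite /= -(subnSK sk); exact: partial_powM.
Qed.

Lemma partials_powM_eq0 k s v w x : smooth v -> smooth w -> v x = 0 ->
  (size s < k)%N -> partials s (fun y => v y ^+ k * w y) x = 0.
Proof.
move=> vS wS vx0 sk; have [w' _ ->] := partials_powM vS wS (ltnW sk).
by rewrite vx0 expr0n subn_eq0 leqNgt sk mul0r.
Qed.

(** Take the product over a in xs of (y_j - a_j) / (x_j - a_j), with j a coordinate where x and a
    differ. *)
Lemma smooth_separating x (xs : seq 'rV[R]_n) : x \notin xs ->
  exists2 u, smooth u & u x = 1 /\ forall y, y \in xs -> u y = 0.
Proof.
elim: xs => [|a xs IHxs]; first by exists (fun=> 1); [exact: smooth_cst|].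
rewrite inE negb_or => /andP[xa /IHxs[u uS [ux uxs]]].
have [j xaj] : exists j, x 0 j != a 0 j.
  apply/not_existsP => xaE; move/eqP: xa; apply; apply/rowP => j.
  by apply/eqP/negP => /negP; exact: xaE.
exists (u \* (((fun y => y 0 j) \+ (fun=> - a 0 j)) \* (fun=> (x 0 j - a 0 j)^-1))).
  apply: (smoothM uS); apply: smoothM (smooth_cst _).
  exact: smoothD (smooth_coord j) (smooth_cst _).
split=> [|y]; first by rewrite /= ux mul1r divff// subr_eq0.
rewrite inE => /orP[/eqP ->|/uxs] /=; first by rewrite subrr mul0r mulr0.
by move=> ->; rewrite mul0r.
Qed.

Lemma smooth_glue k f g x (xs : seq 'rV[R]_n) : smooth f -> smooth g ->
  x \notin xs -> exists2 h, smooth h & forall s, (size s <= k)%N ->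
    partials s h x = partials s f x /\
    forall y, y \in xs -> partials s h y = partials s g y.
Proof.
move=> fS gS /smooth_separating[u uS [ux uxs]].
(* Negation is a product with -1, so that [smoothM] covers it. *)
pose N (w : 'rV[R]_n -> R) := (fun=> -1) \* w.
have NS w (wS : smooth w) : smooth (N w) := smoothM (smooth_cst (-1)) wS.
pose v := (fun=> 1) \+ N (fun x => u x ^+ k.+1).
have vS : smooth v := smoothD (smooth_cst 1) (NS _ (smoothX k.+1 uS)).
pose q y := \sum_(j < k.+1) v y ^+ j.
have qS : smooth q.
  rewrite /q; elim: k.+1 => [|l IHl].
    by under eq_fun do rewrite big_ord0; exact: smooth_cst.
  by under eq_fun do rewrite big_ord_recr/=; exact: (smoothD IHl (smoothX _ vS)).
(* With v = 1 - u^(k+1), the function 1 - v^(k+1) = u^(k+1) q is a cutoff that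
   equals 1 at x and 0 on xs to order k. *)
pose h := f \+ (fun y => v y ^+ k.+1 * (g \+ N f) y).
(* The same h seen from g: the correction is divisible by u^(k+1), hence flat to order k on xs. *)
have hE : h = g \+ (fun y => u y ^+ k.+1 * (q \* (f \+ N g)) y).
  apply/funext => y; rewrite /h /N /=.
  have E : 1 - v y ^+ k.+1 = u y ^+ k.+1 * q y.
    (* Geometric sum: 1 - v^(k+1) = (1 - v) q, and 1 - v = u^(k+1). *)
    rewrite -opprB subrX1 -mulNr opprB; congr (_ * _).
    by rewrite /v /N /= mulN1r opprB addrC subrK.
  by rewrite mulrA -E; move: (v y ^+ k.+1) => t; move: (f y) (g y) => a b; ring.
have fgS w w' (wS : smooth w) (w'S : smooth w') : smooth (w \+ N w') :=
  smoothD wS (NS _ w'S).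
have uqS := smoothM (smoothX k.+1 uS) (smoothM qS (fgS _ _ fS gS)).
have vgS := smoothM (smoothX k.+1 vS) (fgS _ _ gS fS).
exists h; first exact: smoothD fS vgS.
move=> s sk; split=> [|y /uxs uy].
  rewrite (partialsD s fS vgS) /= (partials_powM_eq0 vS (fgS _ _ gS fS)) ?addr0//.
  by rewrite /v /N /= ux expr1n mulr1 subrr.
rewrite hE (partialsD s gS uqS) /=.
by rewrite (partials_powM_eq0 uS (smoothM qS (fgS _ _ fS gS))) ?addr0.
Qed.

End Smooth.

(** * Jets and operators given by a symbol *)

Lemma jet_eq (R : realType) (m r : nat) (p q : jet R m r) :
  jet_pi p = jet_pi q -> jet_fun p = jet_fun q -> p = q.
Proof.
case: p q => x F Fex [y G Gex] /= xy FG; rewrite {}xy {}FG in Fex *.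
by rewrite (Prop_irrelevance Fex Gex).
Qed.

Lemma jet_of_eq (R : realType) (m r : nat) (x : 'rV[R]_m) (f h : Cinf R m) :
  (forall s, (size s <= r)%N -> partials s h x = partials s f x) ->
  jet_of r x h = jet_of r x f.
Proof.
move=> fh; apply: jet_eq => //=; rewrite /jet_class.
have fhD (a : midx m r) : Dmidx a h x = Dmidx a f x.
  (* The list of directions behind [Dmidx a] has length the sum of the entries of a. *)
  apply: fh; apply: leq_trans (valP a).
  rewrite size_flatten /shape -map_comp sumnE big_map big_enum /=.
  by under eq_bigr do rewrite size_nseq.
by apply/seteqP; split => k /= kE a; rewrite kE fhD.
Qed.

Lemma cinf_eq (R : realType) (n : nat) (f g : Cinf R n) : f =1 g -> f = g.
Proof.
case: f g => f fS [g gS] /= /funext fg; case: _ / fg in gS *.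
by rewrite (Prop_irrelevance fS gS).
Qed.

(** The value of D at a point factors through the r-jet there, so gluing jets glues values. *)
Lemma symbol_glue (R : realType) (m r : nat) (D : Cinf R m -> Cinf R m)
    (l : jet R m r -> R) (f g : Cinf R m) (x : 'rV[R]_m) (xs : seq 'rV[R]_m) :
  total_symbol D l -> x \notin xs ->
  exists2 h : Cinf R m, D h x = D f x & forall y, y \in xs -> D h y = D g y.
Proof.
move=> [_ Dl] xxs.
have [h hS hE] := smooth_glue r (cinf_smooth f) (cinf_smooth g) xxs.
exists (MkCinf hS); rewrite ?Dl.
  by congr l; apply: jet_of_eq => s /hE[].
move=> y yxs; rewrite !Dl; congr l; apply: jet_of_eq => s /hE[_].
exact.
Qed.

(** * Sets, pairs and graphs in a superstructure *)

Section Superstructure.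
Variables (X : Type) (V : superstructure X).
Implicit Types (a b c A B z : V) (P Q : set V) (n : nat).

Notation level := (ss_level_of (@elt X V) (@atom X V)).

Lemma level_mono n k : (n <= k)%N -> level n `<=` level k.
Proof.
move=> /subnK <-; elim: (k - n)%N => [//|j IHj] a /IHj; exact: or_introl.
Qed.

Lemma elt_set a A : elt a A -> ss_set A.
Proof. by move=> aA [x _ xA]; apply: (@ss_atom_empty X V x a); rewrite xA. Qed.

(** [ss_collect] is specified only within a level, whence the level bounds that follow. *)
Lemma elt_collect n P a : P `<=` level n -> elt a (ss_collect P) <-> P a.
Proof. by move=> /ss_collectP[]. Qed.

Lemma level_collect n P : P `<=` level n -> level n.+1 (ss_collect P).
Proof. by move=> Pn; have [? PE] := ss_collectP Pn; right; split=> // y /PE/Pn. Qed.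

Lemma collect_inj n P Q : P `<=` level n -> Q `<=` level n ->
  ss_collect P = ss_collect Q -> P = Q.
Proof.
move=> Pn Qn PQ; apply/seteqP; split=> a.
  by move=> /(elt_collect _ Pn); rewrite PQ => /(elt_collect _ Qn).
by move=> /(elt_collect _ Qn); rewrite -PQ => /(elt_collect _ Pn).
Qed.

Lemma level_pair2 a b : exists n, level n a /\ level n b.
Proof.
have [[n na] [k kb]] := (ss_rank a, ss_rank b).
by exists (maxn n k); split; [apply: level_mono na|apply: level_mono kb];
  rewrite (leq_maxl, leq_maxr).
Qed.

Definition upair a b : V := ss_collect [set a; b].

Lemma sub_level2 n a b : level n a -> level n b -> [set a; b] `<=` level n.
Proof. by move=> na nb c [] ->. Qed.

Lemma level_upair n a b : level n a -> level n b -> level n.+1 (upair a b).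
Proof. by move=> na nb; apply/level_collect/sub_level2. Qed.

Lemma elt_upair a b c : elt c (upair a b) <-> c = a \/ c = b.
Proof.
have [n [na nb]] := level_pair2 a b.
exact: elt_collect (sub_level2 na nb).
Qed.

Lemma kpairE a b : kpair a b = upair (upair a a) (upair a b).
Proof. by rewrite /kpair /upair setUid. Qed.

Lemma level_kpair n a b : level n a -> level n b -> level n.+2 (kpair a b).
Proof. by move=> na nb; rewrite kpairE; do 2! apply: level_upair => //. Qed.

(** Expresses pairing by bounded conditions, as [FUpair] needs. *)
Lemma upair_eq a b A : A = upair a b <->
  [/\ elt a A, elt b A & forall c, elt c A -> c = a \/ c = b].
Proof.
split=> [->|[aA bA Aab]].
  by split=> [||c]; rewrite elt_upair; [left|right|].
apply: ss_ext; [exact: elt_set aA| |move=> c].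
  by apply: (@elt_set a); rewrite elt_upair; left.
by rewrite elt_upair; split=> [/Aab|[] ->].
Qed.

Lemma upair_inj a b c d : upair a b = upair c d ->
  (a = c /\ b = d) \/ (a = d /\ b = c).
Proof.
move=> E; have H e : e = a \/ e = b <-> e = c \/ e = d.
  by rewrite -!elt_upair E.
have := H a; have := H b; have := H c; have := H d; intuition congruence.
Qed.

Lemma kpair_inj a b c d : kpair a b = kpair c d -> a = c /\ b = d.
Proof.
rewrite !kpairE => /upair_inj[[/upair_inj ac /upair_inj]|[/upair_inj + /upair_inj]];
  intuition congruence.
Qed.

(** Relational form of [app]: free of choice and default values, it can be written as a bounded
    formula. *)
Definition isapp (F a b : V) : Prop :=
  elt (kpair a b) F /\ forall c, elt (kpair a c) F -> c = b.

Lemma isapp_app F a b : isapp F a b -> app F a = b.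
Proof.
move=> [abF Fb]; rewrite /app; case: pselect => [h|[]]; last by exists b.
by apply: Fb; case: cid.
Qed.

Section CodeGraph.
Variables (S T : Type) (cS : S -> V) (cT : T -> V) (n : nat).
Hypotheses (Sn : forall s, level n (cS s)) (Tn : forall t, level n (cT t)).

Let graph_level (f : S -> T) :
  range (fun s => kpair (cS s) (cT (f s))) `<=` level n.+2.
Proof. by move=> _ [s _ <-]; exact: level_kpair. Qed.

Lemma level_code_graph (f : S -> T) : level n.+3 (code_graph cS cT f).
Proof. exact: level_collect (@graph_level f). Qed.

Lemma isapp_code_graph (f : S -> T) s : injective cS ->
  isapp (code_graph cS cT f) (cS s) (cT (f s)).
Proof.
move=> cS_inj; split; first by apply/(elt_collect _ (@graph_level f)); exists s.
by move=> c /(elt_collect _ (@graph_level f))[s' _ /kpair_inj[/cS_inj -> ->]].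
Qed.

Lemma code_graph_inj (f g : S -> T) : injective cS -> injective cT ->
  code_graph cS cT f = code_graph cS cT g -> f =1 g.
Proof.
move=> cS_inj cT_inj fg s; apply: cT_inj.
rewrite -(isapp_app (isapp_code_graph f s cS_inj)) fg.
exact/isapp_app/isapp_code_graph.
Qed.

End CodeGraph.

(** * Codes of vectors, functions, jets and operators *)

Section Codes.
Variables (R : realType) (iota : R -> X).
Hypothesis iota_inj : injective iota.

(** A pair adds two levels, a graph three, a set one: reals are at 0, vectors at 3, functions at 6,
    sets of functions at 7, jets at 9. *)
Lemma level_code_real t : level 0 (code_real V iota t).
Proof. by exists (iota t). Qed.

Lemma code_real_inj : injective (code_real V iota).
Proof. by move=> s t st; exact: iota_inj (ss_atom_inj st). Qed.

Lemma level_code_vec k (x : 'rV[R]_k) : level 3 (code_vec V iota x).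
Proof. by apply: level_code_graph => *; exact: level_code_real. Qed.

Lemma code_vec_inj k : injective (@code_vec R X V iota k).
Proof.
move=> x y xy; apply/rowP.
apply: (code_graph_inj (n := 0) _ _ _ _ xy).
- by move=> i; exact: level_code_real.
- exact: level_code_real.
(* Indices are coded as reals, and the naturals embed in R. *)
- move=> i j ij; apply/val_inj/eqP; rewrite -(eqr_nat R); apply/eqP.
  exact: code_real_inj ij.
- exact: code_real_inj.
Qed.

Let level3_code_real t : level 3 (code_real V iota t).
Proof. exact: (@level_mono 0 3 isT _ (level_code_real t)). Qed.

Lemma level_code_cinf k (f : Cinf R k) : level 6 (code_cinf V iota f).
Proof. by apply: level_code_graph => //; exact: level_code_vec. Qed.

Lemma isapp_code_cinf k (f : Cinf R k) x :
  isapp (code_cinf V iota f) (code_vec V iota x) (code_real V iota (f x)).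
Proof.
apply: (isapp_code_graph (n := 3)) => //; first exact: level_code_vec.
exact: code_vec_inj.
Qed.

Lemma code_cinf_inj k : injective (@code_cinf R X V iota k).
Proof.
move=> f g fg; apply: cinf_eq; apply: (code_graph_inj (n := 3) _ _ _ _ fg) => //.
- exact: level_code_vec.
- exact: code_vec_inj.
- exact: code_real_inj.
Qed.

(** Serves both for the second component of a jet and for the fibers of D. *)
Definition cinf_set k (P : set (Cinf R k)) : V :=
  ss_collect (@code_cinf R X V iota k @` P).

Let level_image k (P : set (Cinf R k)) :
  @code_cinf R X V iota k @` P `<=` level 6.
Proof. by move=> _ [f _ <-]; exact: level_code_cinf. Qed.

Lemma level_cinf_set k (P : set (Cinf R k)) : level 7 (cinf_set P).
Proof. exact: level_collect (@level_image k P). Qed.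

Lemma elt_cinf_set k (P : set (Cinf R k)) a :
  elt a (cinf_set P) <-> exists2 f, P f & code_cinf V iota f = a.
Proof. exact: elt_collect (@level_image k P). Qed.

Lemma cinf_set_inj k : injective (@cinf_set k).
Proof.
move=> P Q /(collect_inj (@level_image k P) (@level_image k Q)) PQ.
apply/seteqP; split=> f Pf.
  have [g Qg /code_cinf_inj <- //] : (@code_cinf R X V iota k @` Q) (code_cinf V iota f).
  by rewrite -PQ; exists f.
have [g Qg /code_cinf_inj <- //] : (@code_cinf R X V iota k @` P) (code_cinf V iota f).
by rewrite PQ; exists f.
Qed.

Lemma level_code_jet m r (p : jet R m r) : level 9 (code_jet V iota p).
Proof.
apply: level_kpair; last exact: level_cinf_set.
exact: (@level_mono 3 7 isT _ (level_code_vec _)).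
Qed.

Lemma code_jet_inj m r : injective (@code_jet R X V iota m r).
Proof.
by move=> p q /kpair_inj[/code_vec_inj pq /cinf_set_inj PQ]; exact: jet_eq.
Qed.

Lemma isapp_code_symbol m r (l : jet R m r -> R) p :
  isapp (code_symbol V iota l) (code_jet V iota p) (code_real V iota (l p)).
Proof.
apply: (isapp_code_graph (n := 9)); [exact: level_code_jet| |exact: code_jet_inj].
by move=> t; exact: (@level_mono 0 9 isT _ (level_code_real t)).
Qed.

Lemma isapp_code_proj m r (p : jet R m r) :
  isapp (code_proj V iota m r) (code_jet V iota p) (code_vec V iota (jet_pi p)).
Proof.
apply: (isapp_code_graph (n := 9)); [exact: level_code_jet| |exact: code_jet_inj].
by move=> t; exact: (@level_mono 3 9 isT _ (level_code_vec t)).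
Qed.

Lemma isapp_code_operator m (D : Cinf R m -> Cinf R m) f :
  isapp (code_operator V iota D) (code_cinf V iota f) (code_cinf V iota (D f)).
Proof.
by apply: (isapp_code_graph (n := 6)); [exact: level_code_cinf..|exact: code_cinf_inj].
Qed.

Lemma elt_collect_range n (T : Type) (h : T -> V) a :
  (forall t, level n (h t)) -> elt a (ss_collect (range h)) <-> exists t, h t = a.
Proof.
move=> hn; rewrite (@elt_collect n); last by move=> _ [t _ <-].
by split=> [[t _ <-]|[t <-]]; exists t.
Qed.

(** Fibers are indexed by a function h, not by a tuple of values: each one contains h, and no tuple
    needs a code. *)
Definition fibers m (D : Cinf R m -> Cinf R m) (xs : seq 'rV[R]_m) : V :=
  ss_collect (range (fun h : Cinf R m =>
    cinf_set [set f : Cinf R m | forall y, y \in xs -> D f y = D h y])).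

Lemma elt_fibers m (D : Cinf R m -> Cinf R m) xs a : elt a (fibers D xs) <->
  exists h, cinf_set [set f | forall y, y \in xs -> D f y = D h y] = a.
Proof. by apply: (@elt_collect_range 7) => h; exact: level_cinf_set. Qed.

End Codes.

End Superstructure.

(** * Bounded formulas and their meaning *)

Definition FImp p q := FNot (FAnd p (FNot q)).
Definition FEx i j p := FNot (FAll i j (FNot p)).

Section Formulas.
Variables (X : Type) (V : superstructure X).
Implicit Types (e : nat -> V) (i j k : nat).

Definition upd e i a : nat -> V := fun k => if k == i then a else e k.

(** This and the next three lemmas translate a formula into its meaning one connective at a time. *)
Lemma holds_and e p q P Q : (holds e p <-> P) -> (holds e q <-> Q) ->
  holds e (FAnd p q) <-> P /\ Q.
Proof. by move=> pP qQ /=; rewrite pP qQ. Qed.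

Lemma holds_imp e p q P Q : (holds e p <-> P) -> (holds e q <-> Q) ->
  holds e (FImp p q) <-> (P -> Q).
Proof.
move=> pP qQ /=; rewrite pP qQ; split=> [npq hp|pq [hp]]; last by apply; exact: pq.
by apply: contrapT => hq; exact: npq.
Qed.

Lemma holds_all e i j p (P : V -> Prop) : (forall a, holds (upd e i a) p <-> P a) ->
  holds e (FAll i j p) <-> forall a, elt a (e j) -> P a.
Proof. by move=> pP; split=> h a /h /pP. Qed.

Lemma holds_ex e i j p (P : V -> Prop) : (forall a, holds (upd e i a) p <-> P a) ->
  holds e (FEx i j p) <-> exists a, elt a (e j) /\ P a.
Proof.
move=> pP; split=> /= [h|[a [aj /pP pa]] /(_ a aj)//].
by apply: contrapT => nh; apply: h => a aj /pP pa; apply: nh; exists a.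
Qed.

(* Variables 0, ..., 5 are reserved for the quantifiers of these formulas: the
   free variables of [FUpair], [FKpair] and [FApp] must be at least 1, 3 and 6. *)
Definition FUpair i j k := FAnd (FElt j i) (FAnd (FElt k i)
  (FAll 0 i (FImp (FNot (FEq 0 j)) (FEq 0 k)))).

Definition FKpair i j k := FEx 1 i (FEx 2 i
  (FAnd (FUpair 1 j j) (FAnd (FUpair 2 j k) (FUpair i 1 2)))).

(* The quantifier over the values c at j is bounded, since c lies in an element
   of the Kuratowski pair (j, c). *)
Definition FApp i j k := FAnd (FEx 3 i (FKpair 3 j k))
  (FAll 3 i (FAll 4 3 (FAll 5 4 (FImp (FKpair 3 j 5) (FEq 5 k))))).

Lemma holds_upair e i j k :
  holds e (FUpair i.+1 j.+1 k.+1) <-> e i.+1 = upair (e j.+1) (e k.+1).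
Proof.
rewrite upair_eq; have -> : forall P Q S : Prop, [/\ P, Q & S] <-> (P /\ Q /\ S).
  by move=> P Q S; split=> [[]|[? []]].
do 2! apply: holds_and => //; apply: holds_all => a.
rewrite (@holds_imp _ _ _ (a <> e j.+1) (a = e k.+1))//.
by split=> [h|[ej /(_ ej)|]//]; have [|/h] := pselect (a = e j.+1); [left|right].
Qed.

(** The two unordered pairs involved are elements of the Kuratowski pair, which bounds the
    quantifiers over them. *)
Lemma holds_kpair e i j k :
  holds e (FKpair i.+3 j.+3 k.+3) <-> e i.+3 = kpair (e j.+3) (e k.+3).
Proof.
rewrite kpairE (_ : (_ = _) <-> exists u, elt u (e i.+3) /\ exists v, elt v (e i.+3) /\
  (u = upair (e j.+3) (e j.+3) /\ v = upair (e j.+3) (e k.+3) /\ e i.+3 = upair u v)).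
  do 2! apply: holds_ex => ?.
  by do 2! [apply: holds_and; first exact: holds_upair]; exact: holds_upair.
split=> [->|[u [_ [v [_ [-> [->]]]]]]//].
exists (upair (e j.+3) (e j.+3)); rewrite elt_upair; split; first by left.
by exists (upair (e j.+3) (e k.+3)); rewrite elt_upair; split; [right|].
Qed.

Lemma holds_app e i j k :
  holds e (FApp (6 + i) (6 + j) (6 + k)) <-> isapp (e (6 + i)) (e (6 + j)) (e (6 + k)).
Proof.
pose F := e (6 + i)%N; pose a := e (6 + j)%N; pose b := e (6 + k)%N.
apply: iff_trans (_ : _ <-> (exists z, elt z F /\ z = kpair a b) /\
  forall z, elt z F -> forall w, elt w z -> forall c, elt c w -> z = kpair a c -> c = b) _.
  apply: holds_and; first by apply: holds_ex => z; exact: holds_kpair.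
  by do 3! apply: holds_all => ?; apply: holds_imp; first exact: holds_kpair.
rewrite /isapp -/F -/a -/b; split=> [[[z [zF zE]] h]|[abF h]].
  (* The bounds on c are met through {a, c}, which contains c and is an element of the pair. *)
  rewrite zE in zF; split=> // c acF; apply: (h _ acF (upair a c)) => //.
    by rewrite kpairE elt_upair; right.
  by rewrite elt_upair; right.
split; first by exists (kpair a b).
by move=> z zF w _ c _ zE; apply: h; rewrite -zE.
Qed.

End Formulas.

(** * The transferred sentences *)

Section Transfer.
Variables (X Y : Type) (V : superstructure X) (W : superstructure Y).
Variable star : nonstandard_extension V W.

Lemma star_elt (a A : V) : elt a A -> elt (star a) (star A).
Proof. by move=> aA; exact: (star_transfer star (FElt 0 1) (nth a [:: a; A])).1. Qed.

Lemma transfer_nonempty (B : V) : (forall A, elt A B -> exists f, elt f A) ->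
  forall A, elt A (star B) -> exists f, elt f A.
Proof.
(* The body 0 = 0 is trivially true; only the existence of f matters. *)
pose p := FAll 1 0 (FEx 2 1 (FEq 0 0)).
(* Read in any superstructure, so that it applies in both V and W. *)
have pE (Z : Type) (U : superstructure Z) (e : nat -> U) :
    holds e p <-> forall A, elt A (e 0) -> exists f, elt f A /\ e 0 = e 0.
  by apply: holds_all => A; exact: holds_ex.
have := star_transfer star p (fun=> B); rewrite !pE => -[h _] H A AB.
have [|f []] := h _ A AB; last by exists f.
by move=> A' /H[f]; exists f.
Qed.

(** Bounded form of gluing, meant for the fibers over a point, over a list and over the extended
    list. *)
Definition refines Z (U : superstructure Z) (B1 B2 B3 : U) :=
  forall A1, elt A1 B1 -> forall A2, elt A2 B2 -> exists A3, elt A3 B3 /\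
    forall f, elt f A3 -> elt f A1 /\ elt f A2.

Lemma transfer_refines (B1 B2 B3 : V) : refines B1 B2 B3 ->
  refines (star B1) (star B2) (star B3).
Proof.
pose p := FAll 3 0 (FAll 4 1 (FEx 5 2 (FAll 6 5 (FAnd (FElt 6 3) (FElt 6 4))))).
have pE (Z : Type) (U : superstructure Z) (e : nat -> U) :
    holds e p <-> refines (e 0) (e 1) (e 2).
  apply: holds_all => A1; apply: holds_all => A2; apply: holds_ex => A3.
  by apply: holds_all => f; exact: holds_and.
have := star_transfer star p (nth B1 [:: B1; B2; B3]).
by rewrite !pE => -[h _]; exact: h.
Qed.

(** The arguments stand for jets, projection, symbol, operator, point, fibers over it, smooth
    functions, vectors and reals; E and T bound the quantifiers over y and t. *)
Definition pointwise_solvable Z (U : superstructure Z) (J pi l D x B C E T : U) :=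
  forall p, elt p J -> exists y, elt y E /\ isapp pi p y /\
  exists t, elt t T /\ isapp l p t /\ (y = x ->
  exists A, elt A B /\ forall f, elt f A -> elt f C /\
  exists h, elt h C /\ isapp D f h /\ isapp h x t).

Lemma transfer_pointwise_solvable (J pi l D x B C E T : V) :
  pointwise_solvable J pi l D x B C E T ->
  pointwise_solvable (star J) (star pi) (star l) (star D) (star x) (star B)
    (star C) (star E) (star T).
Proof.
pose p := FAll 15 6 (FEx 16 13 (FAnd (FApp 7 15 16) (FEx 17 14
  (FAnd (FApp 8 15 17) (FImp (FEq 16 10) (FEx 18 11 (FAll 19 18
  (FAnd (FElt 19 12) (FEx 20 12 (FAnd (FApp 9 19 20) (FApp 20 10 17))))))))))).
have pE (Z : Type) (U : superstructure Z) (e : nat -> U) : holds e p <->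
    pointwise_solvable (e 6) (e 7) (e 8) (e 9) (e 10) (e 11) (e 12) (e 13) (e 14).
  apply: holds_all => q; apply: holds_ex => y.
  apply: holds_and; first exact: holds_app.
  apply: holds_ex => t; apply: holds_and; first exact: holds_app.
  apply: holds_imp => //; apply: holds_ex => A; apply: holds_all => f.
  apply: holds_and => //; apply: holds_ex => h.
  by apply: holds_and; exact: holds_app.
(* Variables 0 to 5 are reserved: six copies of J are padding, and the seventh is variable 6. *)
have := star_transfer star p
  (nth J [:: J; J; J; J; J; J; J; pi; l; D; x; B; C; E; T]).
by rewrite !pE => -[h _]; exact: h.
Qed.

End Transfer.

(** * Fibers of the operator in the standard world *)

Section Fibers.
Variables (R : realType) (X : Type) (V : superstructure X) (iota : R -> X).
Hypothesis iota_inj : injective iota.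
Variables (m r : nat) (D : Cinf R m -> Cinf R m) (l : jet R m r -> R).
Hypothesis Dl : total_symbol D l.

Lemma fibers_nonempty xs A :
  elt A (fibers V iota D xs) -> exists f, elt f A.
Proof.
move=> /(elt_fibers _ _ _ _)[h <-]; exists (code_cinf V iota h).
by apply/elt_cinf_set; exists h.
Qed.

(** The fiber of a function glued from f at x and g on xs lies in both given fibers. *)
Lemma fibers_refines x xs : x \notin xs ->
  refines (fibers V iota D [:: x]) (fibers V iota D xs) (fibers V iota D (x :: xs)).
Proof.
move=> xxs A1 /elt_fibers[f <-] A2 /elt_fibers[g <-].
have [h hx hxs] := symbol_glue f g Dl xxs.
eexists; split; first by apply/elt_fibers; exists h.
move=> _ /elt_cinf_set[k kE <-].
split; apply/elt_cinf_set; exists k => // y.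
  by rewrite inE => /eqP ->; rewrite kE ?inE ?eqxx.
by move=> yxs; rewrite kE ?inE ?yxs ?orbT// hxs.
Qed.

(** A jet p over x is the jet of some f, and D takes the value l p at x throughout the fiber of
    f. *)
Lemma fiber_solvable x :
  pointwise_solvable (code_Jet V iota m r) (code_proj V iota m r)
    (code_symbol V iota l) (code_operator V iota D) (code_vec V iota x)
    (fibers V iota D [:: x]) (code_Cinf V iota m)
    (ss_collect (range (@code_vec R X V iota m)))
    (ss_collect (range (code_real V iota))).
Proof.
have CE (f : Cinf R m) : elt (code_cinf V iota f) (code_Cinf V iota m).
  by apply/(elt_collect_range _ (@level_code_cinf _ _ _ iota m)); exists f.
move=> _ /(elt_collect_range _ (@level_code_jet _ _ _ iota m r))[p <-].
exists (code_vec V iota (jet_pi p)); split.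
  by apply/(elt_collect_range _ (@level_code_vec _ _ _ iota m)); exists (jet_pi p).
split; first exact: isapp_code_proj.
exists (code_real V iota (l p)); split.
  by apply/(elt_collect_range _ (@level_code_real _ _ _ iota)); exists (l p).
split; first exact: isapp_code_symbol.
move=> /(code_vec_inj iota_inj) px.
have [f pE] : exists f, p = jet_of r x f.
  have [f pf] := jet_ex p; exists f.
  by apply: jet_eq => //=; rewrite pf px.
eexists; split; first by apply/elt_fibers; exists f.
move=> _ /elt_cinf_set[k kE <-]; split; first exact: CE.
exists (code_cinf V iota (D k)); split; first exact: CE.
split; first exact: isapp_code_operator.
have -> : l p = D k x by rewrite pE -Dl.2 kE// inE.
exact: isapp_code_cinf.
Qed.

End Fibers.

(** * From pointwise solvability to a generalized solution by saturation *)

Theorem theorem6p1 (R : realType) (X Y : Type)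
    (V : superstructure X) (W : superstructure Y)
    (star : nonstandard_extension V W) (iota : R -> X)
    (iota_inj : injective iota) (star_sat : polysaturated star)
    (m r : nat) (m_ge1 : (1 <= m)%N)
    (D : Cinf R m -> Cinf R m) (lambda : jet R m r -> R)
    (D_symbol : total_symbol D lambda)
    (g : W) (g_smooth : elt g (star (code_Cinf V iota m)))
    (pcp : sigmaPCP star iota m r (star (code_symbol V iota lambda)) g) :
  exists f : W, generalized_solution star iota D g f.
Proof.
pose B xs : W := star (fibers V iota D xs).
have Bne xs A : elt A (B xs) -> exists f, elt f A.
  by apply: transfer_nonempty => ?; exact: fibers_nonempty.
have /choice[A AP] (x : 'rV[R]_m) : exists A, elt A (B [:: x]) /\
    forall f, elt f A -> elt f (star (code_Cinf V iota m)) /\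
    app (app (star (code_operator V iota D)) f) (star (code_vec V iota x)) =
    app g (star (code_vec V iota x)).
  have [p [pJ px pg]] := pcp x.
  have [y [_ [py [t [_ [pt]]]]]] :=
    transfer_pointwise_solvable (star := star) (fiber_solvable iota_inj D_symbol x) pJ.
  (* Both y and the starred x are the value of the starred projection at p, so the premise equating
     them holds. *)
  rewrite -{1}px -{1}(isapp_app py) => /(_ erefl)[A [AB AP]].
  exists A; split=> // f /AP[fC [h [_ [fh hx]]]]; split=> //.
  by rewrite (isapp_app fh) (isapp_app hx) -pg (isapp_app pt).
(* The lists are standard and finite, so ordinary induction applies; [uniq] keeps each new point off
   the earlier ones, as gluing requires. *)
have fip xs : uniq xs -> exists A', elt A' (B xs) /\
    forall x, x \in xs -> forall f, elt f A' -> elt f (A x).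
  elim: xs => [_|x xs IHxs /= /andP[xxs /IHxs[A2 [A2B A2P]]]].
    eexists; split; last by [].
    (* Over no points every fiber is the whole space; the zero function names it. *)
    by apply/star_elt/elt_fibers; exists (MkCinf (@smooth_cst R m 0)).
  have [A3 [A3B A3P]] := transfer_refines (star := star)
    (fibers_refines (V := V) (iota := iota) D_symbol xxs) (AP x).1 A2B.
  exists A3; split=> // y; rewrite inE => /orP[/eqP ->|yxs] f /A3P[]//.
  by move=> _; exact: A2P.
have [K [VK KV sat]] := star_sat.
(* The family is indexed by standard points, which embed in V by their codes. *)
have rangeV : (range A #<= [set: V])%card.
  apply: card_le_trans (card_image_le A [set: 'rV[R]_m]) _.
  have /card_eqPle[_ vecV] := inj_card_eq (A := [set: 'rV[R]_m])
    (in2W (code_vec_inj (V := V) iota_inj (k := m))).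
  exact: card_le_trans vecV (card_leT _).
have [||||f fP] := sat (range A).
(* Having an element, A x is a set and not an individual. *)
- move=> _ [x _ <-]; have [AB _] := AP x; split; last by exists (fibers V iota D [:: x]).
  by have [f] := Bne _ _ AB; exact: elt_set.
- exact: card_le_trans rangeV VK.
- by move=> /card_le_trans/(_ rangeV).
- move=> G GA Gfin.
  (* Several points may share a set: s picks one for each member of the range, and 0 elsewhere. *)
  have /choice[s sP] (a : W) : exists x, range A a -> A x = a.
    by have [[x _ <-]|] := pselect (range A a); [exists x|exists 0].
  have [xs xsE] := (finite_seqP _).1 (finite_image s Gfin).
  have [A' [/Bne[f fA'] A'P]] := fip _ (undup_uniq xs).
  exists f => a aG; rewrite -(sP _ (GA _ aG)); apply: A'P fA'.
  rewrite mem_undup; suff : [set` xs] (s a) by [].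
  by rewrite -xsE; exists a.
(* Every A x consists of internal smooth functions; the point 0 is used to read this off. *)
exists f; split=> [|x]; first by have [] := (AP 0).2 f (fP _ (imageT A 0)).
by have [_ /(_ f (fP _ (imageT A x)))[]] := AP x.
Qed.
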